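(* Let $A\in M_n(\mathbb{R})$ and $B\in M_{n,m}(\mathbb{R})$ be constant matrices such that $B$ has rank $m$ and $\mathrm{span}\{B,AB,\dots,A^{n-1}B\}=\mathbb{R}^n$ (the columns of these matrices span $\mathbb{R}^n$). Let $\mathcal{J}\subset M_n(\mathbb{R})^2$ be the set of pairs $(A_+,A_-)$ corresponding to optimal syntheses of autonomous LQ problems, equipped with the topology induced by $M_n(\mathbb{R})^2$, and let $\mathcal{J}_p\subset\mathcal{J}$ be the subset of pairs $(A_+,A_-)$ such that $A_+$ and $A_-$ both leave invariant a nontrivial decomposition of $\mathbb{R}^n$. Then the set $\mathcal{J}\setminus\mathcal{J}_p$ contains an open and dense subset of $\mathcal{J}$.
   Context: $M_{n,m}(\mathbb{R})$ denotes real $n\times m$ matrices, $M_n(\mathbb{R})=M_{n,n}(\mathbb{R})$, $\mathrm{Sym}(n)$ the symmetric ones. Autonomous LQ problems (with $(A,B)$ fixed): the dynamics is $\dot x=Ax+Bu$ and the cost is $c(x,u)=x^\top Qx+2x^\top Su+u^\top Ru$ with constant matrices $Q\in\mathrm{Sym}(n)$, $S\in M_{n,m}(\mathbb{R})$, $R\in\mathrm{Sym}(m)$, where $R$ is positive definite and the Hamiltonian matrix $$\begin{pmatrix}A-BR^{-1}S^\top & BR^{-1}B^\top\\ Q-SR^{-1}S^\top & -A^\top+SR^{-1}B^\top\end{pmatrix}$$ has no eigenvalue on the imaginary axis. The optimal synthesis of such a problem is characterized by the pair $(A_+,A_-)$ with $A_\pm=A-BR^{-1}(S^\top+B^\top P_\pm)$,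 where $P_+$ (resp. $P_-$) is the unique (maximal, resp. minimal) symmetric solution of the algebraic Riccati equation $PA+A^\top P-(S+PB)R^{-1}(S^\top+B^\top P)+Q=0$ such that $A_+$ is asymptotically stable, i.e. all its eigenvalues have negative real part (resp. $A_-$ is asymptotically anti-stable, i.e. all its eigenvalues have positive real part). $\mathcal{J}$ is the set of all pairs $(A_+,A_-)$ so obtained as $(Q,S,R)$ varies. A pair leaves invariant a nontrivial decomposition if there are subspaces $E_1,E_2\neq\{0\}$ with $\mathbb{R}^n=E_1\oplus E_2$ and $A_\pm E_i\subset E_i$ for $i=1,2$. *)

(* Defs.v *)
From HB Require Import structures.
From mathcomp Require Import all_boot all_order all_algebra.
From mathcomp Require Import all_classical all_reals all_analysis.
From mathcomp Require Import complex.
Set Implicit Arguments.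
Unset Strict Implicit.
Unset Printing Implicit Defensive.
Import Order.TTheory GRing.Theory Num.Theory.
Import numFieldNormedType.Exports.
Local Open Scope classical_set_scope.
Local Open Scope ring_scope.

Section LQ.
Context {K : realType} {n m : nat}.
Implicit Types (A Ap Am : 'M[K]_n) (B : 'M[K]_(n, m)).
Implicit Types (Q P : 'M[K]_n) (S : 'M[K]_(n, m)) (R : 'M[K]_m).

Definition kalman_span A B : {vspace 'cV[K]_n} :=
  <<[seq col p.2 (A ^+ p.1 *m B) | p : 'I_n * 'I_m]>>%VS.

Definition symmetric_mx (k : nat) (M : 'M[K]_k) : Prop := M^T = M.

Definition positive_definite (k : nat) (M : 'M[K]_k) : Prop :=
  symmetric_mx M /\
  forall u : 'cV[K]_k, u != 0 -> 0 < (u^T *m M *m u) 0 0.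

Definition complex_eigenvalue (k : nat) (M : 'M[K]_k) (z : K[i]) : Prop :=
  eigenvalue (map_mx (real_complex K) M) z.

Definition asymptotically_stable (k : nat) (M : 'M[K]_k) : Prop :=
  forall z : K[i], complex_eigenvalue M z -> complex.Re z < 0.

Definition asymptotically_antistable (k : nat) (M : 'M[K]_k) : Prop :=
  forall z : K[i], complex_eigenvalue M z -> 0 < complex.Re z.

Definition hamiltonian A B Q S R : 'M[K]_(n + n) :=
  block_mx (A - B *m invmx R *m S^T) (B *m invmx R *m B^T)
           (Q - S *m invmx R *m S^T) (- A^T + S *m invmx R *m B^T).

(* The cost [x^T Q x + 2 x^T S u + u^T R u] defines, together with the dynamics
   [x' = A x + B u], an autonomous LQ problem. *)
Definition autonomous_LQ A B Q S R : Prop :=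
  [/\ symmetric_mx Q, positive_definite R &
      forall z : K[i], complex_eigenvalue (hamiltonian A B Q S R) z ->
        complex.Re z != 0].

Definition riccati_solution A B Q S R P : Prop :=
  symmetric_mx P /\
  P *m A + A^T *m P
    - (S + P *m B) *m invmx R *m (S^T + B^T *m P) + Q = 0.

Definition closed_loop A B S R P : 'M[K]_n :=
  A - B *m invmx R *m (S^T + B^T *m P).

(* [Pp] and [Pm] are determined by the (anti-)stability of the closed loop;
   they are the maximal and the minimal symmetric Riccati solutions. *)
Definition LQ_synthesis A B Q S R Ap Am : Prop :=
  exists Pp Pm : 'M[K]_n,
    [/\ riccati_solution A B Q S R Pp,
        Ap = closed_loop A B S R Pp & asymptotically_stable Ap] /\
    [/\ riccati_solution A B Q S R Pm,
        Am = closed_loop A B S R Pm & asymptotically_antistable Am].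

Definition J A B : set ('M[K]_n * 'M[K]_n) :=
  [set X | exists Q S R,
     autonomous_LQ A B Q S R /\ LQ_synthesis A B Q S R X.1 X.2].

Definition invariant_subspace (M : 'M[K]_n) (E : {vspace 'cV[K]_n}) : Prop :=
  forall v : 'cV[K]_n, v \in E -> M *m v \in E.

(* The same decomposition has to be invariant under both matrices. *)
Definition invariant_decomposition Ap Am : Prop :=
  exists E1 E2 : {vspace 'cV[K]_n},
    [/\ E1 != 0%VS, E2 != 0%VS,
        (E1 + E2)%VS = fullv /\ (E1 :&: E2)%VS = 0%VS,
        invariant_subspace Ap E1 /\ invariant_subspace Ap E2 &
        invariant_subspace Am E1 /\ invariant_subspace Am E2].

Definition Jp A B : set ('M[K]_n * 'M[K]_n) :=
  J A B `&` [set X | invariant_decomposition X.1 X.2].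

End LQ.

(* Main.v *)
Require Import Defs.
From HB Require Import structures.
From mathcomp Require Import all_boot all_order all_algebra.
From mathcomp Require Import all_classical all_reals all_analysis.
From mathcomp Require Import complex spectral ring lra.
Set Implicit Arguments.
Unset Strict Implicit.
Unset Printing Implicit Defensive.
Import Order.TTheory GRing.Theory Num.Theory.
Import numFieldNormedType.Exports.
Local Open Scope classical_set_scope.
Local Open Scope ring_scope.

(* With [W = R^-1], [D = P_+ - P_-] and [M = (A_+ + A_-) / 2], the set [J]
   consists of the pairs [(M - B W B^T D / 2, M + B W B^T D / 2)] where [W] and
   [D] are positive definite, [M] is a feedback of [(A, B)] and [D M] is skew:
   positivity of [D] is Lyapunov's theorem, and conversely the stability of the
   closed loops follows from controllability, taking [P_+ = 0] and [P_- = - D].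
   For fixed [D] the pairs [(M + B Y B^T D, W)] with [Y] skew form a convex set,
   so [J] is swept by segments. A decomposition invariant under [A_+] and [A_-]
   yields a nonscalar matrix (the projection) commuting with both. Having only
   scalar commuting matrices is the nonvanishing of a polynomial [phi] in the
   entries of [(A_+, A_-)], hence an open condition, and it suffices to see that
   every segment can be directed towards a pair with [phi != 0]. Identifying
   [B^T D B] with the identity by a Cholesky factorization, this holds as soon
   as [W] is diagonal with distinct entries and the off-diagonal entries of
   [B^T D M B] do not vanish: a matrix commuting with [M] and [B W B^T D] acts
   on the range of [B] as a scalar, hence everywhere by controllability. *)

(** * Lyapunov equations *)

Section Adjoint.
Local Open Scope sesquilinear_scope.
Variable C : numClosedFieldType.

Lemma adjmxM (m n p : nat) (M : 'M[C]_(m, n)) (N : 'M[C]_(n, p)) :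
  (M *m N)^t* = N^t* *m M^t*.
Proof. by rewrite trmx_mul map_mxM. Qed.

Lemma adjmx_block (m1 m2 n1 n2 : nat) (M : 'M[C]_(m1, n1)) (N : 'M[C]_(m1, n2))
    (P : 'M[C]_(m2, n1)) (Q : 'M[C]_(m2, n2)) :
  (block_mx M N P Q)^t* = block_mx (M^t*) (P^t*) (N^t*) (Q^t*).
Proof. by rewrite tr_block_mx map_block_mx. Qed.

Lemma mulmx_adj_ge0 (k : nat) (u : 'rV[C]_k) : 0 <= (u *m u^t*) 0 0.
Proof.
by rewrite mxE sumr_ge0 // => i _; rewrite !mxE mul_conjC_ge0.
Qed.

Lemma mulmx_adj_eq0 (k : nat) (u : 'rV[C]_k) :
  ((u *m u^t*) 0 0 == 0) = (u == 0).
Proof.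
apply/idP/eqP => [|->]; last by rewrite mul0mx mxE.
rewrite mxE psumr_eq0; last by move=> i _; rewrite !mxE mul_conjC_ge0.
move=> /allP u0; apply/rowP => i; have := u0 i (mem_index_enum _).
by rewrite !mxE /= mul_conjC_eq0 => /eqP.
Qed.

(* Induction on the size of a triangular [T]: the Schur complement of the
   leading entry of [D] satisfies the same equation. *)
Lemma lyapunov_trig (n k : nat) (T : 'M[C]_n) : is_trig_mx T ->
  forall (D : 'M[C]_n) (F : 'M[C]_(n, k)),
    (forall i, T i i + (T i i)^* < 0) -> D^t* = D ->
    T *m D + D *m T^t* = - (F *m F^t*) ->
  exists L : 'M[C]_n, D = L *m L^t*.
Proof.
elim/trigsqmx_ind => {n T} [|n t c T trigT IH] D F diagT.
  by move=> _ _; exists 0; apply/matrixP => -[].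
have t_lt0 : t 0 0 + (t 0 0)^* < 0.
  by have := diagT (lshift n 0); rewrite !block_mxEul.
have T_lt0 i : T i i + (T i i)^* < 0.
  by have := diagT (rshift 1 i); rewrite !block_mxEdr.
rewrite -(submxK D) -(vsubmxK F).
move: (ulsubmx D) (ursubmx D) (dlsubmx D) (drsubmx D) => d r l D' {D}.
move: (usubmx F) (dsubmx F) => F0 F1 {F diagT}.
rewrite adjmx_block => /eq_block_mx [dh _ <- D'h] {l}.
rewrite adjmx_block tr_col_mx map_row_mx !mulmx_block mul_col_row add_block_mx.
rewrite opp_block_mx trmx0 map_mx0 !(mul0mx, mulmx0, addr0).
move=> /eq_block_mx [E00 E01 E10 E11].
have d_sc : d = (d 0 0)%:M by exact: mx11_scalar.
have t_sc : t = (t 0 0)%:M by exact: mx11_scalar.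
have E00' : (t 0 0 + (t 0 0)^*) * d 0 0 = - (F0 *m F0^t*) 0 0.
  transitivity ((- (F0 *m F0^t*)) 0 0); last by rewrite mxE.
  by rewrite -E00 !mxE !big_ord1 !mxE !ord1 mulrDl (mulrC (d 0 0)).
have d_ge0 : 0 <= d 0 0.
  by rewrite -(nmulr_rle0 _ t_lt0) E00' oppr_le0 mulmx_adj_ge0.
have td : t^t* = ((t 0 0)^*)%:M by rewrite {1}t_sc tr_scalar_mx map_scalar_mx.
have adjK m1 m2 (M : 'M[C]_(m1, m2)) : (M^t*)^t* = M by exact: trmxCK.
(* When [d] vanishes there is no Schur complement. The leading equation then forces [F0 = 0], and
   the off-diagonal one, whose coefficient [T + conj t] is invertible, forces [r = 0]. *)
have [d0|d_neq0] := eqVneq (d 0 0) 0.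
  have F0_0 : F0 = 0.
    by apply/eqP; rewrite -mulmx_adj_eq0 -oppr_eq0 -E00' d0 mulr0.
  move: d_sc E10 E11; rewrite d0 F0_0 raddf0 => -> E10 E11.
  move: E10; rewrite mulmx0 add0r trmx0 map_mx0 !mulmx0 oppr0 td.
  rewrite mul_mx_scalar -mul_scalar_mx -mulmxDl => E10.
  have TU : T + ((t 0 0)^*)%:M \in unitmx.
    rewrite unitmxE unitfE det_trig.
      apply/prodf_neq0 => i _; rewrite !mxE eqxx mulr1n.
      apply/negP => /eqP/(congr1 (fun z => z + z^*)).
      rewrite rmorphD /= conjCK rmorph0 addr0 addrACA (addrC (t 0 0)^*).
      move=> /eqP; rewrite lt_eqF //.
      by apply: lt_trans (T_lt0 i); rewrite gtrDl.
    apply/is_trig_mxP => i j ij; rewrite !mxE (is_trig_mxP trigT) //.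
    by rewrite -val_eqE (ltn_eqF ij) mulr0n addr0.
  have r0 : r = 0.
    have : r^t* = 0 by rewrite -(mulKmx TU (r^t*)) E10 mulmx0.
    by move=> /(congr1 (fun M => M^t*)); rewrite adjK trmx0 map_mx0.
  move: E11; rewrite r0 trmx0 map_mx0 mulmx0 mul0mx !add0r.
  move=> /(IH _ _ T_lt0 D'h) [L ->].
  exists (block_mx 0 0 0 L); rewrite adjmx_block mulmx_block.
  by rewrite !trmx0 !map_mx0 !(mul0mx, mulmx0, addr0, add0r).
have d_gt0 : 0 < d 0 0 by rewrite lt_neqAle eq_sym d_neq0.
have dV_real : ((d 0 0)^-1)^* = (d 0 0)^-1.
  by rewrite conj_Creal // ger0_real // invr_ge0.
(* Schur complement of [d]; the factor of the right-hand side is modified by the same elimination,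
   so that the equation persists. *)
pose D2 := D' - (d 0 0)^-1 *: (r^t* *m r).
pose F2 := F1 - (d 0 0)^-1 *: (r^t* *m F0).
have F2h : F2^t* = F1^t* - (d 0 0)^-1 *: (F0^t* *m r).
  rewrite /F2 linearB map_mxB linearZ map_mxZ /= dV_real.
  by rewrite adjmxM adjK.
have D2h : D2^t* = D2.
  rewrite /D2 linearB map_mxB linearZ map_mxZ /= dV_real.
  by rewrite adjmxM adjK D'h.
have E2 : T *m D2 + D2 *m T^t* = - (F2 *m F2^t*).
  have F00 : F0 *m F0^t* = (- ((t 0 0 + (t 0 0)^*) * d 0 0))%:M.
    by rewrite E00' opprK -mx11_scalar.
  move: (congr1 (fun M => M *m r) E10) (congr1 (fun M => r^t* *m M) E01) E11.
  rewrite F2h /D2 /F2 td [in X in X -> _]d_sc.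
  rewrite [in X in _ -> X -> _]t_sc [in X in _ -> X -> _]d_sc.
  rewrite !(mulmxDl, mulmxDr, mulmxN, mulNmx) -?scalemxAl -?scalemxAr.
  rewrite -?scalemxAl -?scalemxAr !mulmxA.
  rewrite -(mulmxA _ F0 (F0^t*)) F00 !mul_mx_scalar -?scalemxAl -?scalemxAr.
  move: (c *m r) (r^t* *m r *m T^t*) (T *m r^t* *m r) (F1 *m F0^t* *m r)
    (r^t* *m F0 *m F1^t*) (r^t* *m c^t*) (T *m D') (D' *m T^t*) (F1 *m F1^t*).
  move: (r^t* *m r) => X1 X2 X3 X4 X5 X6 X7 X8 X9 X10.
  move=> /matrixP e1 /matrixP e2 /matrixP e3.
  apply/matrixP => i j.
  move: (e1 i j) (e2 i j) (e3 i j); rewrite !mxE => {}e1 {}e2 {}e3.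
  rewrite -[X5 i j]opprK -e1 -[X6 i j]opprK -e2 -[X10 i j]opprK -e3.
  by field.
have [L DL] := IH _ _ T_lt0 D2h E2.
pose s := sqrtC (d 0 0).
have s_real : s^* = s by rewrite conj_Creal // ger0_real // sqrtC_ge0.
have s_neq0 : s != 0 by rewrite sqrtC_eq0.
have ss : s * s = d 0 0 by rewrite -expr2 sqrtCK.
exists (block_mx s%:M 0 (s^-1 *: r^t*) L).
rewrite adjmx_block mulmx_block !trmx0 !map_mx0 !(mul0mx, mulmx0, addr0).
rewrite linearZ map_mxZ /= adjK tr_scalar_mx map_scalar_mx /= s_real.
rewrite fmorphV /= s_real -scalar_mxM ss -d_sc.
rewrite mul_scalar_mx mul_mx_scalar !scalerA mulfV // !scale1r.
rewrite -scalemxAl -scalemxAr scalerA -invfM ss -DL.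
by rewrite /D2 addrC subrK.
Qed.
End Adjoint.

Section LyapunovEquation.
Local Open Scope sesquilinear_scope.

(** A unitary Schur basis makes [M] triangular with its eigenvalues on the diagonal; the equation
    keeps its form, [D] changing by congruence and [F] by left multiplication. *)
Lemma lyapunov_factor (C : numClosedFieldType) (n k : nat) (M D : 'M[C]_n)
    (F : 'M[C]_(n, k)) :
  (forall a, eigenvalue M a -> a + a^* < 0) -> D^t* = D ->
  M *m D + D *m M^t* = - (F *m F^t*) ->
  exists L : 'M[C]_n, D = L *m L^t*.
Proof.
case: n => [|n] in M D F * => stableM Dh E.
  by exists 0; apply/matrixP => -[].
have [P Pu Ptrig] := Schur M (ltn0Sn n).
have {}Ptrig : is_trig_mx (P *m M *m P^t*) by rewrite -conjymx.
have PV : P^t* *m P = 1%:M.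
  by rewrite -invmx_unitary // mulVmx // unitarymx_unit.
have PVK (p : nat) (N : 'M[C]_(p, n.+1)) : N *m P^t* *m P = N.
  by rewrite -mulmxA PV mulmx1.
have adjK m1 m2 (N : 'M[C]_(m1, m2)) : (N^t*)^t* = N by exact: trmxCK.
have [|||L DL] := lyapunov_trig Ptrig (D := P *m D *m P^t*) (F := P *m F).
- move=> i; apply: stableM; apply/eigenvalueP.
  have /eigenvalueP [v vT v0] :
      eigenvalue (P *m M *m P^t*) ((P *m M *m P^t*) i i).
    rewrite eigenvalue_root_char char_poly_trig // /root horner_prod.
    by rewrite (bigD1 i) //= hornerXsubC subrr mul0r.
  exists (v *m P); first by rewrite scalemxAl -vT !mulmxA PVK.
  apply: contraNneq v0 => vP0; rewrite -[v]mulmx1.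
  by rewrite -(unitarymxP Pu) mulmxA vP0 mul0mx.
- by rewrite !adjmxM adjK Dh !mulmxA.
- rewrite !adjmxM adjK !mulmxA !PVK -mulmxDl.
  by rewrite -!(mulmxA P) -mulmxDr E mulmxN mulNmx !mulmxA.
exists (P^t* *m L).
by rewrite adjmxM adjK mulmxA -(mulmxA _ L) -DL !mulmxA PV mul1mx PVK.
Qed.

End LyapunovEquation.

(** * Real positive definite matrices *)

Section Real.
Variable K : realType.

Lemma eigenvalue_tr (F : fieldType) (n : nat) (M : 'M[F]_n) (a : F) :
  eigenvalue M^T a = eigenvalue M a.
Proof.
rewrite !eigenvalue_root_char; congr (root _ a).
rewrite /char_poly -det_tr /char_poly_mx linearB /= tr_scalar_mx.
by rewrite map_trmx trmxK.
Qed.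

Lemma pd_unitmx (k : nat) (M : 'M[K]_k) : positive_definite M -> M \in unitmx.
Proof.
move=> [Ms Mpd]; rewrite -row_free_unit -kermx_eq0.
apply/eqP/row_matrixP => i; rewrite row0; apply/eqP/negPn/negP => v0.
have /sub_kermxP vM : (row i (kermx M) <= kermx M)%MS by exact: row_sub.
have := Mpd (row i (kermx M))^T; rewrite trmxK vM mul0mx mxE ltxx.
by rewrite trmx_eq0 v0 => /(_ isT).
Qed.

Lemma conj_real_mx (m n : nat) (M : 'M[K]_(m, n)) :
  map_mx Num.conj (map_mx (real_complex K) M) = map_mx (real_complex K) M.
Proof. by apply/matrixP => i j; rewrite !mxE; exact: conjc_real. Qed.

Local Notation cplx := (map_mx (real_complex K)).

(** Over the complex numbers [D = L L^*], so [u^T D u] is the squared norm of [u^T L]; since [D] is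
    invertible so is [L], and the norm vanishes only at 0. *)
Lemma lyapunov_pd (n k : nat) (M D : 'M[K]_n) (F : 'M[K]_(n, k)) :
  asymptotically_stable M -> D^T = D -> D \in unitmx ->
  M *m D + D *m M^T = - (F *m F^T) -> positive_definite D.
Proof.
move=> stableM Ds Du E.
have [|||L DL] := lyapunov_factor (M := cplx M) (D := cplx D) (F := cplx F).
- move=> a /stableM Rea; rewrite /Num.conj /= addcJ.
  by rewrite pmulr_rlt0 ?ltr0n // ltcR.
- by rewrite map_trmx conj_real_mx Ds.
- by rewrite !map_trmx !conj_real_mx -!map_mxM -map_mxD E map_mxN.
split=> // u u0.
have Lu : L \in unitmx.
  have : cplx D \in unitmx by rewrite map_unitmx.
  by rewrite DL unitmx_mul => /andP[].
rewrite -ltcR.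
have -> : (((u^T *m D *m u) 0 0)%:C)%C =
    (cplx u^T *m L *m map_mx Num.conj (cplx u^T *m L)^T) 0 0.
  rewrite adjmxM mulmxA -(mulmxA _ L) -DL map_trmx conj_real_mx trmxK -!map_mxM.
  by rewrite [RHS]mxE.
rewrite lt_neqAle eq_sym mulmx_adj_eq0 mulmx_adj_ge0 andbT.
apply: contraNneq u0 => uL0; rewrite -trmx_eq0 -(map_mx_eq0 (real_complex K)).
by rewrite -(mulmxK Lu (cplx u^T)) uL0 mul0mx.
Qed.

Lemma pd_cholesky (m : nat) (G : 'M[K]_m) : positive_definite G ->
  exists2 T : 'M[K]_m, T \in unitmx & G = T^T *m T.
Proof.
move=> Gpd; suff [T GT] : exists T : 'M[K]_m, G = T^T *m T.
  exists T => //; have := pd_unitmx Gpd.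
  by rewrite GT unitmx_mul => /andP[].
elim: m => [|m IH] in G Gpd *; first by exists 0; apply/matrixP => -[].
rewrite -[m.+1]/(1 + m)%N in G Gpd *.
move: Gpd; rewrite -(submxK G).
move: (ulsubmx G) (ursubmx G) (dlsubmx G) (drsubmx G) => g r l G' {G}.
rewrite (mx11_scalar g); move: (g 0 0) => c {g} [].
rewrite /symmetric_mx tr_block_mx => /eq_block_mx [_ _ <- G's] {l} pd.
have c_gt0 : 0 < c.
  have := pd (col_mx 1%:M 0).
  rewrite -mulmxA mul_block_col tr_col_mx mul_row_col !mulmx0 mulmx1 addr0.
  rewrite trmx0 mul0mx addr0 tr_scalar_mx mul1mx mxE eqxx mulr1n.
  apply; apply/negP => /eqP/matrixP/(_ (lshift m 0) 0).
  by rewrite col_mxEu !mxE eqxx => /eqP; rewrite oner_eq0.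
have [|T GT] := IH (G' - c^-1 *: (r^T *m r)).
  split; first by rewrite /symmetric_mx linearB linearZ /= trmx_mul trmxK G's.
  (* On this vector, whose first coordinate minimizes the form for given [y], the value of [G] is
     that of the Schur complement at [y]. *)
  move=> y y0; have := pd (col_mx (- (c^-1 *: (r *m y))) y).
  rewrite -mulmxA mul_block_col tr_col_mx mul_row_col.
  rewrite mulmxN mul_scalar_mx scalerA mulfV ?gt_eqF // scale1r addNr mulmx0.
  rewrite add0r -mulmxA mulmxBl -scalemxAl mulmxN -scalemxAr mulmxA.
  rewrite [- _ + _]addrC.
  apply; apply: contraNneq y0 => /eqP; rewrite col_mx_eq0 => /andP[_ /eqP->].
  by [].
pose s := Num.sqrt c.
have ss : s * s = c by rewrite -expr2 sqr_sqrtr // ltW.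
have s0 : s != 0 by rewrite gt_eqF // sqrtr_gt0.
exists (block_mx s%:M (s^-1 *: r) 0 T).
rewrite tr_block_mx mulmx_block !trmx0 !(mul0mx, mulmx0, addr0) tr_scalar_mx.
rewrite -scalar_mxM ss mul_scalar_mx mul_mx_scalar [(_ *: _)^T]linearZ /=.
rewrite !scalerA mulfV //.
rewrite !scale1r -scalemxAl -scalemxAr scalerA -invfM ss -GT.
by rewrite addrC subrK.
Qed.
End Real.

Section MatrixEntries.
Variables (R : pzRingType) (m n : nat).
Implicit Types M N : 'M[R]_(m, n).

Lemma zeromxE i j : (0 : 'M[R]_(m, n)) i j = 0.
Proof. by rewrite mxE. Qed.

Lemma addmxE M N i j : (M + N) i j = M i j + N i j.
Proof. by rewrite mxE. Qed.

Lemma oppmxE M i j : (- M) i j = - M i j.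
Proof. by rewrite mxE. Qed.

Lemma scalemxE a M i j : (a *: M) i j = a * M i j.
Proof. by rewrite mxE. Qed.

End MatrixEntries.

(** Expands entries of linear combinations but keeps matrix products opaque, so that [ring] and
    [lra] prove matrix identities entrywise with products as atoms. *)
Definition linmxE := (zeromxE, addmxE, oppmxE, scalemxE).

(** * Controllability and the converse of Lyapunov's theorem *)

Section Control.
Context {K : realType}.
Local Notation cplx := (map_mx (real_complex K)).

Lemma kalman_annihilator (k n m : nat) (A : 'M[K]_n) (B : 'M[K]_(n, m))
    (X : 'M[K]_(k, n)) : kalman_span A B = fullv ->
  (forall i, X *m (A ^+ i *m B) = 0) -> X = 0.
Proof.
move=> AB XAB; have sub : (kalman_span A B <= lker (linfun (mulmx X)))%VS.
  apply/span_subvP => u /mapP[[i j] _ ->].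
  by rewrite memv_ker lfunE /= colE mulmxA XAB mul0mx.
apply/matrixP => i j; have := subvP sub (delta_mx j 0).
rewrite AB memvf memv_ker lfunE /= -colE => /(_ isT)/eqP/matrixP/(_ i 0).
by rewrite !mxE.
Qed.

(** As [X B = 0], the feedback is invisible to [X]: [X A = Z X]. Hence each [X A^i] is a left
    multiple [Y X] and kills [B]. *)
Lemma kalman_feedback (k n m : nat) (A : 'M[K]_n) (B : 'M[K]_(n, m))
    (G : 'M[K]_(m, n)) (X : 'M[K]_(k, n)) (Z : 'M[K]_k) :
  kalman_span A B = fullv -> X *m B = 0 -> X *m (A - B *m G) = Z *m X -> X = 0.
Proof.
move=> AB XB; rewrite mulmxBr mulmxA XB mul0mx subr0 => XA.
apply: kalman_annihilator AB _ => i.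
suff [Y XY] : exists Y, X *m A ^+ i = Y *m X.
  by rewrite mulmxA XY -mulmxA XB mulmx0.
elim: i => [|i [Y XY]]; first by exists 1%:M; rewrite expr0 mulmx1 mul1mx.
by exists (Y *m Z); rewrite exprSr -mulmxE mulmxA XY -mulmxA XA mulmxA.
Qed.

Lemma map_mx_Re (k m n : nat) (v : 'M[K[i]]_(k, m)) (N : 'M[K]_(m, n)) :
  map_mx (@complex.Re K) (v *m cplx N) = map_mx (@complex.Re K) v *m N.
Proof.
apply/matrixP => i j; rewrite !mxE.
rewrite (big_morph (@complex.Re K) (id1 := 0) (op1 := +%R)) //; last first.
  by case=> ? ? [].
apply: eq_bigr => l _; rewrite !mxE; case: (v i l) => a b /=.
by rewrite mulr0 subr0.
Qed.

Lemma map_mx_Im (k m n : nat) (v : 'M[K[i]]_(k, m)) (N : 'M[K]_(m, n)) :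
  map_mx (@complex.Im K) (v *m cplx N) = map_mx (@complex.Im K) v *m N.
Proof.
apply/matrixP => i j; rewrite !mxE.
rewrite (big_morph (@complex.Im K) (id1 := 0) (op1 := +%R)) //; last first.
  by case=> ? ? [].
apply: eq_bigr => l _; rewrite !mxE; case: (v i l) => a b /=.
by rewrite mulr0 add0r.
Qed.

(* One direction of the Popov-Belevitch-Hautus test. *)
Lemma kalman_hautus (n m : nat) (A : 'M[K]_n) (B : 'M[K]_(n, m))
    (G : 'M[K]_(m, n)) (v : 'rV[K[i]]_n) z :
  kalman_span A B = fullv -> v *m cplx B = 0 ->
  v *m cplx (A - B *m G) = z *: v -> v = 0.
Proof.
move=> AB vB; rewrite map_mxB map_mxM mulmxBr mulmxA vB mul0mx subr0 => vA.
have vAB i : v *m cplx (A ^+ i *m B) = 0.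
  suff vAi : v *m cplx (A ^+ i) = z ^+ i *: v.
    by rewrite map_mxM mulmxA vAi -scalemxAl vB scaler0.
  elim: i => [|i IH]; first by rewrite map_mx1 mulmx1 scale1r.
  by rewrite exprSr -mulmxE map_mxM mulmxA IH -scalemxAl vA scalerA exprSr.
have Re0 : map_mx (@complex.Re K) v = 0.
  apply: kalman_annihilator AB _ => i; rewrite -map_mx_Re vAB.
  by apply/matrixP => ? ?; rewrite !mxE.
have Im0 : map_mx (@complex.Im K) v = 0.
  apply: kalman_annihilator AB _ => i; rewrite -map_mx_Im vAB.
  by apply/matrixP => ? ?; rewrite !mxE.
apply/matrixP => i j; move/matrixP/(_ i j): Re0; move/matrixP/(_ i j): Im0.
by rewrite !mxE; case: (v i j) => a b /= -> ->.
Qed.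

Lemma real_mulmx_adj (k n : nat) (v : 'rV[K[i]]_n) (L : 'M[K]_(n, k)) :
  v *m cplx (L *m L^T) *m map_mx Num.conj v^T =
  (v *m cplx L) *m map_mx Num.conj (v *m cplx L)^T.
Proof. by rewrite adjmxM map_trmx conj_real_mx map_mxM !mulmxA. Qed.

(** Evaluating the equation on a left eigenvector [v] of [M] gives [2 Re(z) |v L|^2 = - |v F|^2];
    invertibility of [L] and the hypothesis on [F] make both norms positive. *)
Lemma lyapunov_stable (n k : nat) (M L : 'M[K]_n) (F : 'M[K]_(n, k)) :
  L \in unitmx ->
  (forall (v : 'rV[K[i]]_n) z,
     v *m cplx F = 0 -> v *m cplx M = z *: v -> v = 0) ->
  M *m (L *m L^T) + L *m L^T *m M^T = - (F *m F^T) ->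
  asymptotically_stable M.
Proof.
move=> Lu hautus E z /eigenvalueP[v vM v0].
have vL_gt0 : 0 < (v *m cplx (L *m L^T) *m map_mx Num.conj v^T) 0 0.
  rewrite real_mulmx_adj lt_neqAle eq_sym mulmx_adj_eq0 mulmx_adj_ge0 andbT.
  apply: contraNneq v0 => vL0.
  by rewrite -(@mulmxK _ _ _ (cplx L) _ v) ?map_unitmx // vL0 mul0mx.
have vF_gt0 : 0 < (v *m cplx (F *m F^T) *m map_mx Num.conj v^T) 0 0.
  rewrite real_mulmx_adj lt_neqAle eq_sym mulmx_adj_eq0 mulmx_adj_ge0 andbT.
  by apply: contraNneq v0 => /hautus /(_ vM)->.
have vz : cplx M^T *m map_mx Num.conj v^T = z^* *: map_mx Num.conj v^T.
  rewrite -(conj_real_mx M^T) -[cplx M^T]map_trmx -adjmxM vM.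
  by rewrite linearZ map_mxZ.
have := congr1 (fun N => (v *m cplx N *m map_mx Num.conj v^T) 0 0) E.
rewrite /= map_mxN mulmxN mulNmx oppmxE map_mxD mulmxDr mulmxDl addmxE.
rewrite (map_mxM _ M) (map_mxM _ _ M^T) !mulmxA vM -(mulmxA _ (cplx M^T)) vz.
rewrite -scalemxAr -!scalemxAl !scalemxE -mulrDl addcJ => E'.
move: vF_gt0; rewrite -oppr_lt0 -E' pmulr_llt0 // pmulr_rlt0 ?ltr0n //.
by rewrite ltcR.
Qed.
End Control.

(** * Description of [J] *)

Section Synthesis.
Context {K : realType}.
Local Notation cplx := (map_mx (real_complex K)).

Lemma pd_invmx (k : nat) (M : 'M[K]_k) :
  positive_definite M -> positive_definite (invmx M).
Proof.
move=> Mpd; have Mu := pd_unitmx Mpd; have [Ms M_gt0] := Mpd.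
have Is : (invmx M)^T = invmx M by rewrite trmx_inv Ms.
split=> // u u0; have := M_gt0 (invmx M *m u).
rewrite trmx_mul Is -!mulmxA mulKVmx //; apply.
by apply: contraNneq u0 => Mu0; rewrite -(mulKVmx Mu u) Mu0 mulmx0.
Qed.

(* The two closed loops agree on the kernel of [D], where one would be stable
   and the other antistable. *)
Lemma stable_antistable_unitmx (n : nat) (D N Ap Am : 'M[K]_n) :
  asymptotically_stable Ap -> asymptotically_antistable Am ->
  Am = Ap + N *m D -> N^T = N -> D^T = D ->
  D *m Ap + Ap^T *m D + D *m N *m D = 0 -> D \in unitmx.
Proof.
move=> stableAp antiAm AmE Ns Ds E.
rewrite -row_free_unit -kermx_eq0 -mxrank_eq0 eqn0Ngt; apply/negP => r_gt0.
have [V [VD Vfree Vsub]] : exists V : 'M[K]_(\rank (kermx D), n),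
    [/\ V *m D = 0, row_free V &
        forall (U : 'M[K]_(\rank (kermx D), n)), U *m D = 0 -> (U <= V)%MS].
  exists (row_base (kermx D)); rewrite row_base_free; split=> // [|U UD].
    by apply/sub_kermxP; rewrite eq_row_base.
  by rewrite eq_row_base; apply/sub_kermxP.
have VAp : V *m Ap^T *m D = 0.
  have := congr1 (mulmx V) E.
  rewrite !mulmxDr !mulmxA.
  by rewrite VD !mul0mx add0r addr0 mulmx0.
have /submxP[Z VZ] := Vsub _ VAp.
have VAm : V *m Am^T = Z *m V.
  by rewrite AmE linearD /= trmx_mul Ns Ds mulmxDr VZ mulmxA VD mul0mx addr0.
(* [Z] represents both [Ap^T] and [Am^T] on the kernel of [D], so each complex eigenvalue of [Z] is
   an eigenvalue of both closed loops. *)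
have [z /eigenvalueP[w wZ w0]] := eigenvalue_closed (cplx Z) r_gt0.
have wV0 : w *m cplx V != 0.
  by rewrite mulmx_free_eq0 // row_free_map.
have Hz (M : 'M[K]_n) : V *m M^T = Z *m V -> complex_eigenvalue M z.
  move=> VM; rewrite /complex_eigenvalue -eigenvalue_tr map_trmx.
  apply/eigenvalueP; exists (w *m cplx V) => //.
  by rewrite -mulmxA -map_mxM VM map_mxM mulmxA wZ scalemxAl.
by have := lt_trans (stableAp _ (Hz _ VZ)) (antiAm _ (Hz _ VAm)); rewrite ltxx.
Qed.

Variables (n m : nat) (A : 'M[K]_n) (B : 'M[K]_(n, m)).
Hypothesis AB : kalman_span A B = fullv.

Lemma J_gramian (X : 'M[K]_n * 'M[K]_n) : J A B X ->
  exists (D M : 'M[K]_n) (W : 'M[K]_m) (G : 'M[K]_(m, n)),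
    [/\ positive_definite D, positive_definite W, M = A - B *m G,
        D *m M + M^T *m D = 0 &
        X = (M - 2^-1 *: (B *m W *m B^T *m D),
             M + 2^-1 *: (B *m W *m B^T *m D))].
Proof.
case: X => Ap Am [Q [S [R [[Qs Rpd _] [Pp [Pm []]]]]]] /=.
move=> [[Pps Ep] ApE Aps] [[Pms Em] AmE Ams].
have := pd_invmx Rpd; move: ApE AmE Ep Em; rewrite /closed_loop.
move: (invmx R) => W ApE AmE Ep Em Wpd; have [Ws _] := Wpd.
have [T Tu WT] := pd_cholesky Wpd.
pose D := Pp - Pm.
have Ds : D^T = D by rewrite /D linearB /= Pps Pms.
have AmD : Am = Ap + B *m W *m B^T *m D.
  rewrite ApE AmE /D !(mulmxDr, mulmxN) !mulmxA.
  apply/matrixP => i j; rewrite !linmxE; ring.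
have Ns : (B *m W *m B^T)^T = B *m W *m B^T.
  by rewrite !trmx_mul trmxK Ws mulmxA.
(* Difference of the two Riccati equations, written around [Ap]. *)
have E : D *m Ap + Ap^T *m D + D *m (B *m W *m B^T) *m D = 0.
  have -> : Ap^T = A^T - (S + Pp *m B) *m W *m B^T.
    rewrite ApE linearB /= !trmx_mul linearD /= !trmx_mul !trmxK Ws Pps.
    by rewrite mulmxA.
  move: Ep Em; rewrite ApE /D.
  rewrite !(mulmxDl, mulmxDr, mulmxN, mulNmx, opprD, opprK) !mulmxA.
  move=> /matrixP Ep /matrixP Em; apply/matrixP => i j.
  move: (Ep i j) (Em i j).
  rewrite !linmxE.
  lra.
clearbody D.
have Du := stable_antistable_unitmx Aps Ams AmD Ns Ds E.
(* [M] is the mean of [Ap] and [Am], and its gain the mean of the two feedback gains, which differ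
   by [W B^T D]. *)
exists D, (Ap + 2^-1 *: (B *m W *m B^T *m D)), W,
  (W *m (S^T + B^T *m Pp) - 2^-1 *: (W *m B^T *m D)).
split; [|exact: Wpd| | |].
(* [E] is a Lyapunov equation for the stable matrix [Ap^T] with right-hand side [- F F^T], where
   [F = D B T^T] and [W = T^T T]. *)
- apply: (@lyapunov_pd _ _ _ Ap^T D (D *m B *m T^T) _ Ds Du).
    move=> z; rewrite /complex_eigenvalue -map_trmx eigenvalue_tr.
    exact: Aps.
  rewrite trmxK !trmx_mul trmxK Ds.
  move: E; rewrite WT !mulmxA => /eqP; rewrite addr_eq0 => /eqP <-.
  by rewrite addrC.
- rewrite ApE !(mulmxDr, mulmxN, mulmxDl) -!scalemxAr !mulmxA.
  by apply/matrixP => i j; rewrite !linmxE; ring.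
- rewrite [(_ + _)^T]linearD /= [(_ *: _)^T]linearZ /= !trmx_mul trmxK Ds Ws.
  rewrite mulmxDr mulmxDl -scalemxAl -scalemxAr.
  move: E; rewrite !mulmxA => /matrixP E.
  apply/matrixP => i j; move: (E i j); rewrite !linmxE.
  lra.
- rewrite addrK AmD -addrA -scalerDl; congr (_, _ + _).
  have -> : 2^-1 + 2^-1 = 1 :> K by lra.
  by rewrite scale1r.
Qed.

(** Multiplying by [D^-1] on both sides gives [M D^-1 + D^-1 M^T = - B W B^T], a Lyapunov equation
    in [D^-1]; the factor [B L^T], with [W = L^T L], has the same left kernel as [B]. *)
Lemma closed_loop_stable (D M : 'M[K]_n) (W : 'M[K]_m) :
  positive_definite D -> positive_definite W ->
  (forall (v : 'rV[K[i]]_n) z,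
     v *m cplx B = 0 -> v *m cplx M = z *: v -> v = 0) ->
  D *m M + M^T *m D + D *m B *m W *m B^T *m D = 0 ->
  asymptotically_stable M.
Proof.
move=> Dpd Wpd hautus E.
have [T Tu DT] := pd_cholesky Dpd; have [L Lu WL] := pd_cholesky Wpd.
have Du := pd_unitmx Dpd.
have DV : invmx T *m (invmx T)^T = invmx D.
  apply: (can_inj (mulKmx Du)); rewrite mulmxV // {1}DT -mulmxA mulKVmx //.
  by rewrite -trmx_mul mulVmx // trmx1.
apply: (@lyapunov_stable _ _ _ M (invmx T) (B *m L^T)).
- by rewrite unitmx_inv.
- move=> v z; rewrite map_mxM mulmxA => vBL; apply: hautus.
  rewrite -(@mulmxK _ _ _ (cplx L^T) _ (v *m cplx B)); last first.
    by rewrite map_unitmx unitmx_tr.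
  by rewrite vBL mul0mx.
rewrite DV trmx_mul trmxK.
have := congr1 (fun N => invmx D *m N *m invmx D) E.
rewrite !mulmxDr !mulmxDl !mulmxA mulVmx // !mul1mx.
rewrite -!(mulmxA _ D) mulmxV // !mulmx1 mulmx0 mul0mx WL.
rewrite !mulmxA => /eqP; rewrite addr_eq0 => /eqP.
exact.
Qed.

(** The realizing cost is the square [(u + H x)^T W^-1 (u + H x)], where [H] is the gain of
    [A_+ = M - N / 2]. Its Riccati equation has the solutions 0 and [- D]. *)
Lemma gramian_J (D M : 'M[K]_n) (W : 'M[K]_m) (G : 'M[K]_(m, n)) :
  positive_definite D -> positive_definite W -> M = A - B *m G ->
  D *m M + M^T *m D = 0 ->
  J A B (M - 2^-1 *: (B *m W *m B^T *m D), M + 2^-1 *: (B *m W *m B^T *m D)).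
Proof.
move=> Dpd Wpd ME MD; set N := B *m W *m B^T *m D.
have [Ds _] := Dpd; have [Ws _] := Wpd; have Wu := pd_unitmx Wpd.
have NT : N^T = D *m B *m W *m B^T by rewrite !trmx_mul trmxK Ds Ws !mulmxA.
pose H := G + 2^-1 *: (W *m B^T *m D).
have ApE : M - 2^-1 *: N = A - B *m H.
  rewrite ME /H /N mulmxDr -scalemxAr !mulmxA.
  by apply/matrixP => i j; rewrite !linmxE; ring.
have NE : D *m N = D *m B *m W *m B^T *m D by rewrite /N !mulmxA.
have MH : D *m (M - 2^-1 *: N) + (M - 2^-1 *: N)^T *m D + D *m N = 0.
  rewrite [(_ - _)^T]linearB /= [(_ *: _)^T]linearZ /= NT.
  rewrite mulmxBr mulmxBl -scalemxAl -scalemxAr NE.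
  move/matrixP: MD => MD; apply/matrixP => i j; move: (MD i j).
  by rewrite !linmxE; lra.
have stable_p : asymptotically_stable (M - 2^-1 *: N).
  apply: (closed_loop_stable Dpd Wpd); last by rewrite -NE.
  by move=> v z vB; rewrite ApE; apply: kalman_hautus AB vB.
have antistable_m : asymptotically_antistable (M + 2^-1 *: N).
  (* Time reversal: [- (M + N / 2)] satisfies the same equation as [M - N / 2]. *)
  have stable_Nm : asymptotically_stable (- (M + 2^-1 *: N)).
    apply: (closed_loop_stable Dpd Wpd).
      have -> : M + 2^-1 *: N = A - B *m (G - 2^-1 *: (W *m B^T *m D)).
        rewrite ME /N mulmxBr -scalemxAr !mulmxA.
        by apply/matrixP => i j; rewrite !linmxE; ring.
      move=> v z vB; rewrite map_mxN mulmxN => /(canRL (@opprK _)).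
      by rewrite -(scaleNr z); apply: kalman_hautus AB vB.
    rewrite [(- _)^T]linearN /= [(_ + _)^T]linearD /= [(_ *: _)^T]linearZ /= NT.
    rewrite mulmxN mulNmx mulmxDr mulmxDl -scalemxAl -scalemxAr -NE.
    move/matrixP: MD => MD; apply/matrixP => i j; move: (MD i j).
    by rewrite !linmxE; lra.
  move=> z /eigenvalueP[v vM v0].
  have : complex_eigenvalue (- (M + 2^-1 *: N)) (- z).
    by apply/eigenvalueP; exists v; rewrite // map_mxN mulmxN vM scaleNr.
  by move=> /stable_Nm; case: (z) => a b /=; rewrite oppr_lt0.
clearbody H.
have RW : invmx (invmx W) = W by exact: invmxK.
have Rpd := pd_invmx Wpd; have [Rs _] := Rpd.
have ST : (H^T *m invmx W)^T = invmx W *m H by rewrite trmx_mul trmxK Rs.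
have BWS : B *m W *m (invmx W *m H) = B *m H by rewrite mulmxA mulmxK.
have SWS : H^T *m invmx W *m W *m (invmx W *m H) = H^T *m invmx W *m H.
  by rewrite mulmxKV // mulmxA.
exists (H^T *m invmx W *m H), (H^T *m invmx W), (invmx W); split.
  split; last 1 first.
  (* As [Q - S R^-1 S^T = 0], the Hamiltonian is block triangular with diagonal blocks [A_+] and
     [- A_+^T], whose eigenvalues avoid the imaginary axis. *)
  - rewrite /hamiltonian RW ST BWS SWS subrr mulmxKV //.
    have -> : - A^T + H^T *m B^T = - (M - 2^-1 *: N)^T.
      by rewrite ApE [(_ - _)^T]linearB /= trmx_mul opprB addrC.
    rewrite -ApE => z /eigenvalueP[v]; rewrite -[v]hsubmxK.
    move: (lsubmx v) (rsubmx v) => v1 v2.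
    rewrite map_block_mx mul_row_block scale_row_mx map_mx0 mulmx0 addr0.
    move=> /eq_row_mx [v1M v2M].
    have [v10|v1_neq0 _] := eqVneq v1 0; last first.
      by rewrite lt_eqF // stable_p //; apply/eigenvalueP; exists v1.
    rewrite v10 row_mx_eq0 eqxx /= => v2_neq0.
    have /stable_p : complex_eigenvalue (M - 2^-1 *: N) (- z).
      rewrite /complex_eigenvalue -eigenvalue_tr map_trmx.
      apply/eigenvalueP; exists v2 => //.
      move: v2M; rewrite v10 mul0mx add0r map_mxN mulmxN scaleNr => <-.
      by rewrite opprK.
    by case: (z) => a b /=; rewrite oppr_lt0 => /gt_eqF ->.
  - by rewrite /symmetric_mx !trmx_mul trmxK Rs !mulmxA.
  - exact: Rpd.
exists 0, (- D); rewrite /riccati_solution /closed_loop /= RW ST.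
split; split.
- split; first by rewrite /symmetric_mx trmx0.
  by rewrite !(mul0mx, mulmx0, addr0, add0r) SWS addrC subrr.
- by rewrite mulmx0 addr0 BWS ApE.
- exact: stable_p.
- split; first by rewrite /symmetric_mx linearN /= Ds.
  move: MH; rewrite ApE [(_ - _)^T]linearB /= trmx_mul NE.
  rewrite !(mulmxDl, mulmxDr, mulmxN, mulNmx) !mulmxA.
  rewrite !(mulmxKV Wu) !(mulmxK Wu) => /matrixP MH.
  by apply/matrixP => i j; move: (MH i j); rewrite !linmxE; lra.
- rewrite mulmxDr BWS !mulmxN mulmxA -/N opprB addrCA -ApE.
  by apply/matrixP => i j; rewrite !linmxE; lra.
- exact: antistable_m.
Qed.
End Synthesis.

(** * Scalar commutants *)

Section Commutant.
Context {K : realType}.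

(** Commuting with a diagonal matrix with distinct entries forces [Z] to be diagonal; each
    off-diagonal entry of [N] then equates two diagonal entries of [Z]. *)
Lemma diag_commutant (F : fieldType) (k : nat) (d : 'rV[F]_k) (N Z : 'M[F]_k) :
  (forall i j, i != j -> d 0 i != d 0 j) ->
  (forall i j, i != j -> N i j != 0) ->
  Z *m diag_mx d = diag_mx d *m Z -> Z *m N = N *m Z ->
  exists a, Z = a%:M.
Proof.
case: k => [|k] in d N Z * => d_inj N_neq0 Zd ZN.
  by exists 0; apply/matrixP => -[].
have Zij i j : i != j -> Z i j = 0.
  move=> ij; move/matrixP/(_ i j): Zd; rewrite mul_mx_diag mul_diag_mx !mxE.
  rewrite mulrC => /eqP; rewrite -subr_eq0 -mulrBl mulf_eq0 subr_eq0.
  by rewrite eq_sym (negbTE (d_inj _ _ ij)) => /eqP.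
have ZNij i j : i != j -> Z i i = Z j j.
  move=> ij; move/matrixP/(_ i j): ZN.
  rewrite !mxE (bigD1 i) //= [X in _ + X]big1 ?addr0; last first.
    by move=> l li; rewrite Zij ?mul0r // eq_sym.
  rewrite (bigD1 j) //= [X in _ + X]big1 ?addr0; last first.
    by move=> l lj; rewrite Zij ?mulr0.
  by rewrite mulrC => /(mulfI (N_neq0 _ _ ij)).
exists (Z 0 0); apply/matrixP => i j; rewrite !mxE.
have [<-|/Zij ->] := eqVneq i j; last by rewrite mulr0n.
by rewrite mulr1n; have [->//|/ZNij] := eqVneq i 0.
Qed.

Lemma pd_congr (k l : nat) (M : 'M[K]_k) (L : 'M[K]_(k, l)) :
  positive_definite M -> (forall u : 'cV_l, L *m u = 0 -> u = 0) ->
  positive_definite (L^T *m M *m L).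
Proof.
move=> [Ms M_gt0] L_inj; split.
  by rewrite /symmetric_mx !trmx_mul trmxK Ms mulmxA.
move=> u u0; have := M_gt0 (L *m u); rewrite trmx_mul !mulmxA; apply.
by apply: contraNneq u0 => /L_inj ->.
Qed.

Lemma pd_diag (k : nat) (d : 'rV[K]_k) :
  (forall i, 0 < d 0 i) -> positive_definite (diag_mx d).
Proof.
move=> d_gt0; split=> [|u u_neq0]; first by rewrite /symmetric_mx tr_diag_mx.
rewrite -mulmxA mul_diag_mx.
have -> : (u^T *m \matrix_(i, j) (d 0 i * u i j)) 0 0 =
    \sum_i d 0 i * u i 0 ^+ 2.
  by rewrite mxE; apply: eq_bigr => i _; rewrite !mxE; ring.
have sum_ge0 i : true -> 0 <= d 0 i * u i 0 ^+ 2.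
  by rewrite mulr_ge0 ?sqr_ge0 // ltW.
rewrite lt_neqAle eq_sym sumr_ge0 // andbT psumr_eq0 //.
apply: contra_neqN u_neq0 => /allP u0; apply/colP => i.
have := u0 i (mem_index_enum _).
by rewrite mxE mulf_eq0 gt_eqF //= sqrf_eq0 => /eqP.
Qed.

(** [O] and [W] are the target of the deformation at fixed [D]. In the coordinates given by
    [P = B^T D B = T^T T], [W P] and [W B^T D M1 B] become [diag d] and [diag d N], as
    [diag_commutant] requires. *)
Lemma trivial_commutant (n m : nat) (A D M : 'M[K]_n) (B : 'M[K]_(n, m))
    (G : 'M[K]_(m, n)) :
  kalman_span A B = fullv -> \rank B = m -> positive_definite D ->
  M = A - B *m G -> D *m M + M^T *m D = 0 ->
  exists O W : 'M[K]_m,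
    [/\ O^T = - O, positive_definite W &
        forall X : 'M[K]_n,
          X *m (M + B *m O *m B^T *m D) = (M + B *m O *m B^T *m D) *m X ->
          X *m (B *m W *m B^T *m D) = (B *m W *m B^T *m D) *m X ->
        exists a, X = a%:M].
Proof.
move=> AB rankB Dpd ME MD; have [Ds _] := Dpd.
have /row_fullP[B' BK] : row_full B by rewrite /row_full rankB.
pose P := B^T *m D *m B.
have Ppd : positive_definite P.
  by apply: pd_congr => // u Bu; rewrite -[u]mul1mx -BK -mulmxA Bu mulmx0.
have BDB : B^T *m D *m B = P by [].
clearbody P.
have Pu := pd_unitmx Ppd; have [Ps _] := Ppd.
have [T Tu PT] := pd_cholesky Ppd.
(* Distinct positive entries 1, ..., m, and a skew matrix whose off-diagonal entries are 1 or -1. *)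
pose d : 'rV[K]_m := \row_i i.+1%:R.
pose N : 'M[K]_m := \matrix_(i, j) ((i < j)%N%:R - (j < i)%N%:R).
have Ns : N^T = - N.
  by apply/matrixP => i j; rewrite !mxE opprB.
(* Solution of [P O P + B^T D M B = T^T N T]; it is skew because [N] and [D M] are. *)
pose O := invmx P *m (T^T *m N *m T - B^T *m D *m M *m B) *m invmx P.
have MDs : M^T *m D = - (D *m M) by apply/eqP; rewrite -addr_eq0 addrC MD.
have Hs : (B^T *m D *m M *m B)^T = - (B^T *m D *m M *m B).
  rewrite !trmx_mul trmxK Ds mulmxA -!mulmxA (mulmxA M^T) MDs.
  by rewrite mulNmx mulmxN !mulmxA.
have Os : O^T = - O.
  rewrite /O !trmx_mul trmx_inv Ps [(_ - _)^T]linearB /= Hs !trmx_mul trmxK Ns.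
  by rewrite mulNmx mulmxN -opprD mulNmx mulmxN !mulmxA.
have OE : P *m O *m P = T^T *m N *m T - B^T *m D *m M *m B.
  by rewrite /O !mulmxA mulmxV // mul1mx mulmxKV.
clearbody O.
pose W := invmx T *m diag_mx d *m (invmx T)^T.
have Wpd : positive_definite W.
  rewrite /W -[in X in X *m _ *m _](trmxK (invmx T)); apply: pd_congr.
    by apply: pd_diag => i; rewrite mxE ltr0n.
  move=> u Tu0; rewrite -[u](@mulKmx _ _ _ (invmx T)^T) ?Tu0 ?mulmx0 //.
  by rewrite unitmx_tr unitmx_inv.
exists O, W; split=> // X; set M1 := M + _ => XM XS.
have PE : B^T *m D *m M1 *m B = T^T *m N *m T.
  rewrite /M1 mulmxDr mulmxDl.
  have -> : B^T *m D *m (B *m O *m B^T *m D) *m B = P *m O *m P.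
    by rewrite -BDB !mulmxA.
  by rewrite OE addrC subrK.
have WPE : W *m P = invmx T *m diag_mx d *m T.
  by rewrite /W PT mulmxA trmx_inv mulmxKV ?unitmx_tr.
have WPu : W *m P \in unitmx by rewrite unitmx_mul Pu pd_unitmx.
have WN : W *m (T^T *m N *m T) = invmx T *m (diag_mx d *m N) *m T.
  by rewrite /W !mulmxA trmx_inv mulmxKV ?unitmx_tr.
clearbody W; pose Z := B' *m X *m B.
(* [X] preserves the range of [B]: it commutes with [B W B^T D], which sends [B] to [B (W P)] with
   [W P] invertible. [Z] is the matrix of [X] on that range. *)
have XB : X *m B = B *m Z.
  have SB : B *m W *m B^T *m D *m B = B *m (W *m P) by rewrite -BDB !mulmxA.
  have XBE : X *m B = B *m (W *m B^T *m D *m X *m B *m invmx (W *m P)).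
    by rewrite -[in LHS](mulmxK WPu B) -SB 2!mulmxA XS !mulmxA.
  by rewrite /Z -(mulmxA B') XBE !(mulmxA B') BK mul1mx.
clearbody Z.
have ZW : Z *m W *m B^T *m D = W *m B^T *m D *m X.
  rewrite -[LHS]mul1mx -[RHS]mul1mx -BK -!(mulmxA B'); congr (B' *m _).
  by rewrite !mulmxA -XB -!mulmxA !mulmxA in XS *.
have ZWP : Z *m (W *m P) = W *m P *m Z.
  by rewrite -BDB !mulmxA ZW -(mulmxA _ X B) XB !mulmxA.
have ZWN : Z *m (W *m (T^T *m N *m T)) = W *m (T^T *m N *m T) *m Z.
  rewrite -PE !mulmxA ZW -(mulmxA _ X) XM.
  by rewrite -!mulmxA XB.
have TZT (Y : 'M[K]_m) : Z *m (invmx T *m Y *m T) = invmx T *m Y *m T *m Z ->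
    (T *m Z *m invmx T) *m Y = Y *m (T *m Z *m invmx T).
  move=> /(congr1 (fun C => T *m C *m invmx T)); rewrite !mulmxA.
  by rewrite (mulmxV Tu) mul1mx mulmxK // mulmxA.
have [||||a ZE] := @diag_commutant _ _ d (diag_mx d *m N) (T *m Z *m invmx T).
- by move=> i j ij; rewrite !mxE eqr_nat eqSS.
- move=> i j ij; rewrite mul_diag_mx !mxE mulf_neq0 ?pnatr_eq0 //.
  move: ij; rewrite -val_eqE /=; case: ltngtP => //= _ _;
    by rewrite ?subr0 ?sub0r ?oppr_eq0 oner_eq0.
- by apply: TZT; rewrite -WPE.
- by apply: TZT; rewrite -WN.
have {}ZE : Z = a%:M.
  rewrite -[Z](mulKmx Tu) -[T *m Z](mulmxKV Tu) ZE.
  by rewrite mul_scalar_mx -scalemxAr mulVmx // scalemx1.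
(* [X - a] kills [B] and commutes with [M1], a feedback of [(A, B)], so controllability makes it
   vanish. *)
exists a; apply/eqP; rewrite -subr_eq0; apply/eqP.
apply: (@kalman_feedback _ _ _ _ A B (G - O *m B^T *m D) _ M1 AB).
  by rewrite mulmxBl XB ZE mul_mx_scalar mul_scalar_mx subrr.
have -> : A - B *m (G - O *m B^T *m D) = M1.
  by rewrite /M1 ME mulmxBr !mulmxA opprB addrA addrAC.
by rewrite mulmxBl mulmxBr XM mul_scalar_mx mul_mx_scalar.
Qed.
End Commutant.

(** * Scalar commutants as a nonvanishing determinant *)

Section CommutantDeterminant.
Context {K : realType} {n : nat}.
Implicit Types M N X : 'M[K]_n.

Definition commutator_mx M : 'M[K]_(n * n) := lin_mulmxr M - lin_mulmx M.

(* A Gram matrix whose kernel consists of the (vectorized) matrices commuting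
   with [M] and [N] and orthogonal to the identity. *)
Definition commutant_gram M N : 'M[K]_(n * n) :=
  commutator_mx M *m (commutator_mx M)^T +
  commutator_mx N *m (commutator_mx N)^T +
  (mxvec (1%:M : 'M[K]_n))^T *m mxvec (1%:M : 'M[K]_n).

Lemma mul_commutator_mx X M :
  mxvec X *m commutator_mx M = mxvec (X *m M - M *m X).
Proof. by rewrite mulmxBr !mul_vec_lin -linearB. Qed.

Lemma mulmx_tr_ge0 (k : nat) (u : 'rV[K]_k) : 0 <= (u *m u^T) 0 0.
Proof. by rewrite mxE sumr_ge0 // => i _; rewrite mxE -expr2 sqr_ge0. Qed.

Lemma mulmx_tr_eq0 (k : nat) (u : 'rV[K]_k) : (u *m u^T) 0 0 = 0 -> u = 0.
Proof.
rewrite mxE => /eqP; rewrite psumr_eq0; last first.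
  by move=> i _; rewrite mxE -expr2 sqr_ge0.
move=> /allP u0; apply/rowP => i; have := u0 i (mem_index_enum _).
by rewrite !mxE /= -expr2 sqrf_eq0 => /eqP.
Qed.

(** Pairing [v] times the Gram matrix with [v^T] gives the sum of the squared norms of the three
    products. *)
Lemma commutant_gram_eq0 (v : 'rV[K]_(n * n)) M N :
  v *m commutant_gram M N = 0 <->
  [/\ v *m commutator_mx M = 0, v *m commutator_mx N = 0 &
      v *m (mxvec (1%:M : 'M[K]_n))^T = 0].
Proof.
rewrite /commutant_gram; move: (commutator_mx M) (commutator_mx N) => CM CN.
split=> [v0|[vM vN v1]]; last first.
  by rewrite !mulmxDr !mulmxA vM vN v1 !mul0mx !addr0.
have := congr1 (fun w => (w *m v^T) 0 0) v0.
have sq k (F : 'M[K]_(n * n, k)) :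
    v *m (F *m F^T) *m v^T = (v *m F) *m (v *m F)^T.
  by rewrite trmx_mul !mulmxA.
have := sq _ (mxvec (1%:M : 'M[K]_n))^T; rewrite trmxK => sq1.
rewrite !mulmxDr !mulmxDl !sq sq1 mul0mx !linmxE => /eqP.
rewrite paddr_eq0 ?addr_ge0 ?mulmx_tr_ge0 // => /andP[+ /eqP/mulmx_tr_eq0 ->].
rewrite paddr_eq0 ?mulmx_tr_ge0 // => /andP[].
by move=> /eqP/mulmx_tr_eq0 -> /eqP/mulmx_tr_eq0 ->.
Qed.

Lemma det_commutant_gram_neq0 M N :
  \det (commutant_gram M N) != 0 <->
  (forall X, X *m M = M *m X -> X *m N = N *m X -> exists a, X = a%:M).
Proof.
split=> [det_neq0 X XM XN|scalar]; last first.
  (* A kernel vector commutes with both matrices, hence is scalar; being orthogonal to the identity,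
     it is orthogonal to itself. *)
  apply/negP => /det0P[v v0 /commutant_gram_eq0[vM vN v1]].
  move: vM vN; rewrite -[v]vec_mxK !mul_commutator_mx.
  move=> /eqP; rewrite mxvec_eq0 subr_eq0 => /eqP vM.
  move=> /eqP; rewrite mxvec_eq0 subr_eq0 => /eqP vN.
  have [a va] := scalar _ vM vN; move: v0; rewrite -(inj_eq (can_inj vec_mxK)).
  have ve : v = a *: mxvec (1%:M : 'M[K]_n).
    by rewrite -[LHS]vec_mxK va -(scalemx1 _ a) [mxvec (_ *: _)]linearZ.
  have : v = 0.
    by apply: mulmx_tr_eq0; rewrite {2}ve linearZ /= -scalemxAr v1 scaler0 mxE.
  by move=> ->; rewrite eqxx.
set one := mxvec (1%:M : 'M[K]_n).
(* This case also covers size 0, where the identity vanishes and [b] would be 0. *)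
have [->|one_neq0] := eqVneq X 0; first by exists 0; rewrite raddf0.
(* [b X - c] is [b] times the component of [X] orthogonal to the identity for the entrywise inner
   product; it still commutes with both matrices, so it lies in the trivial kernel. *)
pose b := (one *m one^T) 0 0; pose c := (mxvec X *m one^T) 0 0.
have bX : b *: X - c%:M = 0.
  apply/eqP; rewrite -mxvec_eq0; apply: contraNT det_neq0 => v0.
  apply/det0P; exists (mxvec (b *: X - c%:M)) => //; apply/commutant_gram_eq0.
  rewrite !mul_commutator_mx; split; last first.
  - have -> : mxvec (b *: X - c%:M) = b *: mxvec X - c *: one.
      by rewrite -(scalemx1 _ c) [LHS]linearB /= ![mxvec (_ *: _)]linearZ.
    rewrite mulmxBl -!scalemxAl.
    rewrite [one *m _]mx11_scalar [mxvec X *m _]mx11_scalar -/b -/c.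
    by rewrite !scale_scalar_mx mulrC subrr.
  - rewrite mulmxBl mulmxBr -scalemxAl -scalemxAr XN.
    by rewrite mul_scalar_mx mul_mx_scalar subrr linear0.
  - rewrite mulmxBl mulmxBr -scalemxAl -scalemxAr XM.
    by rewrite mul_scalar_mx mul_mx_scalar subrr linear0.
have b_neq0 : b != 0.
  apply: contra_neqN one_neq0 => /eqP/mulmx_tr_eq0/eqP.
  rewrite mxvec_eq0 => /eqP one0.
  by rewrite -[X]mulmx1 one0 mulmx0.
exists (b^-1 * c); move/eqP: bX; rewrite subr_eq0 => /eqP bX.
by rewrite -scale_scalar_mx -bX scalerA mulVf // scale1r.
Qed.

End CommutantDeterminant.

(** * Genericity *)

Section EntrywiseClosure.
Context {K : realType} {T : Type}.
Variable P : (T -> K) -> Prop.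
Hypothesis Pcst : forall c, P (fun=> c).
Hypothesis PD : forall f g, P f -> P g -> P (fun t => f t + g t).
Hypothesis PM : forall f g, P f -> P g -> P (fun t => f t * g t).

Let Peq f g : f =1 g -> P g -> P f.
Proof. by move=> /funext ->. Qed.

Let Psum (I : Type) (r : seq I) (F : I -> T -> K) :
  (forall i, P (F i)) -> P (fun t => \sum_(i <- r) F i t).
Proof.
move=> PF; elim: r => [|i r IH].
  by apply: Peq (Pcst 0) => t; rewrite big_nil.
by apply: Peq (PD (PF i) IH) => t; rewrite big_cons.
Qed.

Let Pprod (I : Type) (r : seq I) (F : I -> T -> K) :
  (forall i, P (F i)) -> P (fun t => \prod_(i <- r) F i t).
Proof.
move=> PF; elim: r => [|i r IH].
  by apply: Peq (Pcst 1) => t; rewrite big_nil.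
by apply: Peq (PM (PF i) IH) => t; rewrite big_cons.
Qed.

Let Pmx (k l : nat) (F : T -> 'M[K]_(k, l)) := forall i j, P (fun t => F t i j).

Let PmxD (k l : nat) (F G : T -> 'M[K]_(k, l)) :
  Pmx F -> Pmx G -> Pmx (fun t => F t + G t).
Proof.
by move=> PF PG i j; apply: Peq (PD (PF i j) (PG i j)) => t; rewrite mxE.
Qed.

Let PmxN (k l : nat) (F : T -> 'M[K]_(k, l)) : Pmx F -> Pmx (fun t => - F t).
Proof.
move=> PF i j; apply: Peq (PM (Pcst (-1)) (PF i j)) => t.
by rewrite mxE mulN1r.
Qed.

Let PmxM (k l p : nat) (F : T -> 'M[K]_(k, l)) (G : T -> 'M[K]_(l, p)) :
  Pmx F -> Pmx G -> Pmx (fun t => F t *m G t).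
Proof.
move=> PF PG i j; apply: Peq (Psum _ (fun l => PM (PF i l) (PG l j))) => t.
by rewrite mxE.
Qed.

Let Pmx_tr (k l : nat) (F : T -> 'M[K]_(k, l)) :
  Pmx F -> Pmx (fun t => (F t)^T).
Proof. by move=> PF i j; apply: Peq (PF j i) => t; rewrite mxE. Qed.

Let Pmx_lin (k l k' l' : nat) (F : T -> 'M[K]_(k, l) -> 'M[K]_(k', l')) :
  (forall X, Pmx (F^~ X)) -> Pmx (fun t => lin_mx (F t)).
Proof.
move=> PF i j; case/mxvec_indexP: j => a b.
apply: Peq (PF (vec_mx (delta_mx 0 i)) a b) => t.
by rewrite !mxE /= mxvecE.
Qed.

Let Pmx_commutator (n : nat) (F : T -> 'M[K]_n) :
  Pmx F -> Pmx (fun t => commutator_mx (F t)).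
Proof.
move=> PF; apply: PmxD; last apply: PmxN.
  by apply: Pmx_lin => X; apply: PmxM.
by apply: Pmx_lin => X; apply: PmxM.
Qed.

(** The determinant is a polynomial in the entries, so it stays in any class of functions containing
    the constants and closed under sums and products. The classes of interest are continuous
    functions of the pair and polynomial functions along a line. *)
Lemma det_commutant_gram_closed (n : nat) (F G : T -> 'M[K]_n) :
  (forall i j, P (fun t => F t i j)) -> (forall i j, P (fun t => G t i j)) ->
  P (fun t => \det (commutant_gram (F t) (G t))).
Proof.
move=> PF PG; apply: Psum => s; apply: PM => //; apply: Pprod => i.
apply: (PmxD (PmxD _ _)) => //.
- by apply: PmxM; [|apply: Pmx_tr]; apply: Pmx_commutator.
- by apply: PmxM; [|apply: Pmx_tr]; apply: Pmx_commutator.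
Qed.

End EntrywiseClosure.

(** * Continuity, polynomial dependence and invariant decompositions *)

Section Genericity.
Context {K : realType}.

Lemma continuous_det_commutant_gram (n : nat) :
  continuous (fun X : 'M[K]_n * 'M[K]_n => \det (commutant_gram X.1 X.2)).
Proof.
apply: (det_commutant_gram_closed (T := ('M[K]_n * 'M[K]_n)%type)
  (P := fun f => continuous f)) => [c|f g|f g|i j|i j].
- by move=> X; exact: cvg_cst.
- by move=> cf cg X; apply: cvgD; [exact: cf|exact: cg].
- by move=> cf cg X; apply: cvgM; [exact: cf|exact: cg].
- move=> X.
  apply: (@cvg_comp _ _ _ fst (fun M : 'M[K]_n => M i j) _ (nbhs X.1)).
    exact: cvg_fst.
  exact: coord_continuous.
- move=> X.
  apply: (@cvg_comp _ _ _ snd (fun M : 'M[K]_n => M i j) _ (nbhs X.2)).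
    exact: cvg_snd.
  exact: coord_continuous.
Qed.

Lemma det_commutant_gram_poly (n : nat) (M M' N N' : 'M[K]_n) :
  exists p : {poly K}, forall s,
    \det (commutant_gram (M + s *: M') (N + s *: N')) = p.[s].
Proof.
have lin a b : exists p : {poly K}, forall s, a + s * b = p.[s].
  by exists (a%:P + b *: 'X) => s; rewrite !hornerE mulrC.
apply: (det_commutant_gram_closed (T := K)
  (P := fun f => exists p : {poly K}, forall s, f s = p.[s])).
- by move=> c; exists c%:P => s; rewrite hornerC.
- by move=> f g [p fp] [q gq]; exists (p + q) => s; rewrite hornerD fp gq.
- by move=> f g [p fp] [q gq]; exists (p * q) => s; rewrite hornerM fp gq.
- move=> i j; have [p pE] := lin (M i j) (M' i j).
  by exists p => s; rewrite !mxE.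
- move=> i j; have [p pE] := lin (N i j) (N' i j).
  by exists p => s; rewrite !mxE.
Qed.

Lemma poly_small_nonroot (p : {poly K}) (e : K) :
  p != 0 -> 0 < e -> exists s, [/\ 0 < s, s < e & p.[s] != 0].
Proof.
(* [size p] distinct points, more than [p] has roots; the shift by 2 keeps them strictly below
   [e]. *)
move=> p0 e0; pose u (i : nat) := e / i.+2%:R.
have u_inj : injective u.
  move=> i j /(mulfI (lt0r_neq0 e0))/invr_inj/eqP.
  by rewrite eqr_nat => /eqP[].
have : ~~ all (root p) [seq u i | i <- iota 0 (size p)].
  apply/negP => rp; have := max_poly_roots p0 rp.
  by rewrite map_inj_uniq // iota_uniq size_map size_iota ltnn => /(_ isT).
rewrite -has_predC => /hasP[_ /mapP[i _ ->] /= pi]; exists (u i); split=> //.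
  by rewrite divr_gt0.
by rewrite ltr_pdivrMr // ltr_pMr // ltr1n.
Qed.

(** The projection onto [E1] along [E2] commutes with both matrices; it is the identity on [E1] and
    zero on [E2], both nonzero, hence not scalar. *)
Lemma decomposition_commutant (n : nat) (Ap Am : 'M[K]_n) :
  invariant_decomposition Ap Am ->
  exists2 X : 'M[K]_n, X *m Ap = Ap *m X /\ X *m Am = Am *m X &
    forall a, X <> a%:M.
Proof.
move=> [E1 [E2 [E1_neq0 E2_neq0 [E12 E12_0] [Ap1 Ap2] [Am1 Am2]]]].
pose f : 'End('cV[K]_n) := daddv_pi E1 E2.
pose X : 'M[K]_n := \matrix_(i, j) f (delta_mx j 0) i 0.
have XE v : X *m v = f v.
  apply/colP => i; rewrite mxE {2}[v]matrix_sum_delta linear_sum summxE.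
  apply: eq_bigr => j _; rewrite big_ord1 linearZ /= !mxE.
  by rewrite mulrC.
have X1 v : v \in E1 -> X *m v = v by move=> vE; rewrite XE daddv_pi_id.
have X2 v : v \in E2 -> X *m v = 0.
  move=> vE; have := daddv_pi_add E12_0 (w := v).
  rewrite E12 memvf (daddv_pi_id _ vE) 1?capvC // => /(_ isT).
  by rewrite XE => /(canRL (addrK _)); rewrite subrr.
have XM (M : 'M[K]_n) : invariant_subspace M E1 -> invariant_subspace M E2 ->
    X *m M = M *m X.
  move=> M1 M2; suff XMv (v : 'cV[K]_n) : X *m M *m v = M *m X *m v.
    apply/matrixP => i j; have := XMv (delta_mx j 0).
    by rewrite -!colE => /colP/(_ i); rewrite !mxE.
  have : v \in (E1 + E2)%VS by rewrite E12 memvf.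
  move=> /memv_addP[v1 v1E [v2 v2E ->]].
  rewrite -!mulmxA !mulmxDr (X1 _ v1E) (X2 _ v2E) mulmx0 addr0.
  by rewrite (X1 _ (M1 _ v1E)) (X2 _ (M2 _ v2E)) addr0.
exists X; first by split; exact: XM.
move=> a Xa; have := memv_pick E1; have := memv_pick E2.
have p1 : vpick E1 != 0 by rewrite vpick0.
have p2 : vpick E2 != 0 by rewrite vpick0.
move=> /X2; rewrite Xa mul_scalar_mx => /eqP.
rewrite scaler_eq0 (negbTE p2) orbF => /eqP a0 /X1.
by rewrite Xa a0 raddf0 mul0mx => p10; rewrite -p10 eqxx in p1.
Qed.

End Genericity.

(** * Segments inside [J] *)

Section Perturbation.
Context {K : realType}.

Lemma pd_segment (k : nat) (W W1 : 'M[K]_k) (s : K) :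
  positive_definite W -> positive_definite W1 -> 0 <= s <= 1 ->
  positive_definite (W + s *: (W1 - W)).
Proof.
move=> [Ws W_gt0] [W1s W1_gt0] /andP[s_ge0 s_le1]; split.
  rewrite /symmetric_mx [LHS]linearD /= [(_ *: _)^T]linearZ /=.
  by rewrite [(_ - _)^T]linearB /= Ws W1s.
move=> u u0; rewrite mulmxDr mulmxDl -scalemxAr -scalemxAl mulmxBr mulmxBl.
by rewrite !linmxE; have := W_gt0 _ u0; have := W1_gt0 _ u0; nra.
Qed.

(** At fixed [D], [M] moves along [B Y B^T D] with [Y] skew while [W] moves towards [W1]; skewness
    of [D M] and positivity of [W] persist on [[0, 1]]. *)
Lemma J_segment (n m : nat) (A : 'M[K]_n) (B : 'M[K]_(n, m))
    (X : 'M[K]_n * 'M[K]_n) :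
  kalman_span A B = fullv -> \rank B = m -> J A B X ->
  exists Yp Ym : 'M[K]_n,
    (forall s, 0 <= s <= 1 -> J A B (X.1 + s *: Yp, X.2 + s *: Ym)) /\
    \det (commutant_gram (X.1 + Yp) (X.2 + Ym)) != 0.
Proof.
move=> AB rankB /J_gramian[D [M [W [G [Dpd Wpd ME MD ->]]]]] /=.
have [Y [W1 [Ys W1pd triv]]] := trivial_commutant AB rankB Dpd ME MD.
have [Ds _] := Dpd.
pose N (V : 'M[K]_m) := B *m V *m B^T *m D.
exists (N Y - 2^-1 *: N (W1 - W)), (N Y + 2^-1 *: N (W1 - W)); split=> [s s01|].
  have MsE : M + s *: N Y = A - B *m (G - s *: (Y *m B^T *m D)).
    rewrite ME mulmxBr -scalemxAr /N !mulmxA.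
    by apply/matrixP => i j; rewrite !linmxE; ring.
  have MsD : D *m (M + s *: N Y) + (M + s *: N Y)^T *m D = 0.
    rewrite [(_ + _)^T]linearD /= [(_ *: _)^T]linearZ /=.
    rewrite /N !trmx_mul trmxK Ys Ds.
    rewrite mulmxDr mulmxDl -scalemxAr -scalemxAl !(mulmxN, mulNmx) !mulmxA.
    move/matrixP: MD => MD; apply/matrixP => i j; move: (MD i j).
    by rewrite !linmxE; lra.
  have := gramian_J AB Dpd (pd_segment Wpd W1pd s01) MsE MsD.
  have -> : B *m (W + s *: (W1 - W)) *m B^T *m D = N W + s *: N (W1 - W).
    by rewrite /N mulmxDr !mulmxDl -scalemxAr -!scalemxAl.
  congr (J A B (_, _)); apply/matrixP => i j; rewrite !linmxE; ring.
apply/det_commutant_gram_neq0 => Z.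
have N1 : N W1 = N W + N (W1 - W).
  by rewrite /N mulmxBr !mulmxBl addrC subrK.
have -> : M - 2^-1 *: N W + (N Y - 2^-1 *: N (W1 - W)) = M + N Y - 2^-1 *: N W1.
  by rewrite N1; apply/matrixP => i j; rewrite !linmxE; ring.
have -> : M + 2^-1 *: N W + (N Y + 2^-1 *: N (W1 - W)) = M + N Y + 2^-1 *: N W1.
  by rewrite N1; apply/matrixP => i j; rewrite !linmxE; ring.
(* Commuting with [S - T / 2] and [S + T / 2] amounts to commuting with their mean [S] and their
   difference [T]. *)
move: (triv Z); rewrite -[B *m Y *m B^T *m D]/(N Y) -[B *m W1 *m _ *m _]/(N W1).
move: (M + N Y) (N W1) => S T {}triv.
rewrite mulmxBr mulmxBl mulmxDr mulmxDl -!scalemxAl -!scalemxAr.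
move=> /matrixP Zp /matrixP Zm; apply: triv; apply/matrixP => i j;
  by move: (Zp i j) (Zm i j); rewrite !linmxE; lra.
Qed.

End Perturbation.

Theorem theorem4p8 (K : realType) (n m : nat)
    (A : 'M[K]_n) (B : 'M[K]_(n, m))
    (rankB : \rank B = m)
    (kalman : kalman_span A B = fullv) :
  exists U : set (set_type (J A B)),
    [/\ open U, dense U & set_val @` U `<=` J A B `\` Jp A B].
Proof.
pose phi (X : 'M[K]_n * 'M[K]_n) := \det (commutant_gram X.1 X.2).
have phi_open : open [set X | phi X != 0].
  have /continuousP := @continuous_det_commutant_gram K n.
  by move=> /(_ [set x | x != 0]); apply; exact: open_neq.
exists (set_val @^-1` [set X | phi X != 0]); split.
- by exists [set X | phi X != 0].
- move=> O [x Ox] [V oV VO].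
  have JX : J A B (set_val x) by exact: set_valP.
  have : V (set_val x) by move: Ox; rewrite -VO.
  case: (set_val x) JX => Xp Xm JX VX.
  have [Yp [Ym [Jseg phi1]]] := J_segment kalman rankB JX.
  pose g s := (Xp + s *: Yp, Xm + s *: Ym).
  have g_cvg : g s @[s --> (0 : K)] --> (Xp, Xm).
    have affine (P Q : 'M[K]_n) : P + s *: Q @[s --> (0 : K)] --> P.
      have : P + s *: Q @[s --> (0 : K)] --> P + 0 *: Q.
        by apply: cvgD; [exact: cvg_cst|apply: cvgZr_tmp; exact: cvg_id].
      by rewrite scale0r addr0.
    apply: (@cvg_pair _ _ _ (nbhs (0 : K)) (nbhs Xp) (nbhs Xm)); exact: affine.
  have : \forall s \near (0 : K), V (g s).
    by apply: g_cvg; exact: open_nbhs_nbhs.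
  move=> /nbhs_ballP[e /= e0 eV].
  have [p pE] := det_commutant_gram_poly Xp Yp Xm Ym.
  (* At parameter 1 the segment ends at a pair where [phi] is nonzero. *)
  have p0 : p != 0.
    apply: contraNneq phi1 => p0.
    by have := pE 1; rewrite !scale1r p0 horner0 => ->.
  (* Below [e] the pair stays in the open set [V]; below 1 it stays on the segment inside [J]. *)
  have [|s [s0 se ps]] := poly_small_nonroot (e := Num.min e 1) p0.
    by rewrite lt_min e0 ltr01.
  move: se; rewrite lt_min => /andP[se s1].
  have Js : g s \in J A B by rewrite inE; apply: Jseg; rewrite !ltW.
  exists (SigSub Js); split; last by rewrite /= /phi /= pE.
  rewrite -VO /=; apply: eV.
  by rewrite /ball /= sub0r normrN gtr0_norm.
(* An invariant decomposition would give a nonscalar matrix commuting with both, which [phi != 0]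
   excludes. *)
- move=> _ [x phix <-]; split; first exact: set_valP.
  move=> [_ /decomposition_commutant[X [Xp Xm] X_nscalar]].
  have [a] := (det_commutant_gram_neq0 _ _).1 phix X Xp Xm.
  exact: X_nscalar.
Qed.
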